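(* Let $K$ be a real closed field, $L=K(i)$ with $i^2=-1$, and let $\sigma:L\to L$ be the complex conjugation (the $K$-automorphism with $\sigma(i)=-i$). Let $n\ge 1$ and let $M,N\in M_{n,n}(L)$ be such that $M^\dagger=M$ and $N^\dagger=N$. Then the joint numerical range $\mathrm{Num}(M,N)\subset L^2$ is a closed, bounded and $\Delta$-convex subset of $K^2$.
   Context: $M_{n,n}(L)$ is the set of $n\times n$ matrices over $L$. For $M=(m_{ij})$, $M^\dagger:=(\sigma(m_{ji}))$ is the $\sigma$-conjugate transpose. For $u,v\in L^n$ set $\langle u,v\rangle:=\sum_{i=1}^n\sigma(u_i)v_i$. The joint numerical range of $M,N\in M_{n,n}(L)$ is $\mathrm{Num}(M,N):=\{(\langle u,Mu\rangle,\langle u,Nu\rangle)\mid u\in L^n,\ \langle u,u\rangle=1\}\subseteq L^2$. $\Delta:=\{a\sigma(a)\mid a\in L\}\subseteq K$ and $1-\Delta:=\{1-s\mid s\in\Delta\}$. A subset $S$ of $L^2$ (or of $K^2$) is $\Delta$-convex if for all $a,b\in S$ with $a\ne b$ it contains all elements $ta+(1-t)b$ with $t\in\Delta\cap(1-\Delta)$. ''Closed'' and ''bounded'' refer to the euclidean topology on $K^2$ induced by the order of $K$. *)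

(* Defs.v *)
From HB Require Import structures.
From mathcomp Require Import all_boot all_order all_algebra.
From mathcomp Require Import complex.
From mathcomp Require Import boolp classical_sets topology normedtype.
Import Order.TTheory GRing.Theory Num.Theory.
Import numFieldNormedType.Exports.

Set Implicit Arguments.
Unset Strict Implicit.
Unset Printing Implicit Defensive.

Local Open Scope classical_set_scope.
Local Open Scope complex_scope.
Local Open Scope ring_scope.

Definition dagger (K : rcfType) (n : nat) (M : 'M[K[i]]_n) : 'M[K[i]]_n :=
  \matrix_(i, j) conjc (M j i).

Definition sform (K : rcfType) (n : nat) (u v : 'cV[K[i]]_n) : K[i] :=
  \sum_(i < n) conjc (u i ord0) * v i ord0.

Definition joint_num_range (K : rcfType) (n : nat) (M N : 'M[K[i]]_n) :
    set (K[i] * K[i]) :=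
  [set (sform u (M *m u), sform u (N *m u)) | u in [set u | sform u u = 1]].

Definition Delta (K : rcfType) : set K :=
  [set s | exists a : K[i], s%:C = a * conjc a].

Arguments Delta : clear implicits.

Definition Delta_convex (K : rcfType) (S : set (K * K)) : Prop :=
  forall a b : K * K, S a -> S b -> a <> b ->
  forall t : K, (Delta K `&` [set 1 - s | s in Delta K]) t ->
  S (t *: a + (1 - t) *: b).

(* The inclusion of K^2 into K[i]^2; a subset of K[i]^2 contained in its range
   is viewed as a subset of K^2 by taking the preimage. *)
Definition real_pair (K : rcfType) (p : K * K) : K[i] * K[i] :=
  (p.1%:C, p.2%:C).

(* Main.v *)
Require Import Defs.
From HB Require Import structures.
From mathcomp Require Import all_boot all_order all_algebra.
From mathcomp Require Import complex polyrcf.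
From mathcomp Require Import boolp classical_sets topology normedtype.
From mathcomp Require Import ring lra.
Import Order.TTheory GRing.Theory Num.Theory.
Import numFieldNormedType.Exports.

(* No compactness is available over K, so closedness is obtained algebraically.
   If (a, b) is not in Num(M, N), then M - a and N - b have no common isotropic
   vector, and some real combination of them is positive definite, hence bounded
   below on the unit sphere; this separates (a, b) from Num(M, N).
   Two tools give the definite combination. The first is the Toeplitz-Hausdorff
   theorem in homogeneous form (which also yields convexity). The second is a
   germ argument: if a hermitian matrix A(s) depends polynomially on s and is
   eventually positive, along a filter, on every polynomial family of nonzero
   vectors, then A(s) is eventually positive definite. It is applied at 0+, and
   at a hypothetical gap in the order of K that would arise if every
   combination were indefinite. *)

Set Implicit Arguments.
Unset Strict Implicit.
Unset Printing Implicit Defensive.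

Local Open Scope classical_set_scope.
Local Open Scope complex_scope.
Local Open Scope ring_scope.

Local Notation ReC := (@complex.Re _).
Local Notation ImC := (@complex.Im _).

(** * Hermitian forms over [K[i]] with values in [K] *)

Lemma ReD (K : rcfType) (x y : K[i]) : ReC (x + y) = ReC x + ReC y.
Proof. by case: x y => [? ?] [? ?]. Qed.

Lemma ReMr (K : rcfType) (a : K) (x : K[i]) : ReC (a%:C * x) = a * ReC x.
Proof. by case: x => [? ?] /=; rewrite mul0r subr0. Qed.

Lemma Re_conjc (K : rcfType) (x : K[i]) : ReC (conjc x) = ReC x.
Proof. by case: x. Qed.

Lemma conjc_mulE (K : rcfType) (x : K[i]) :
  conjc x * x = (ReC x ^+ 2 + ImC x ^+ 2)%:C.
Proof. by rewrite add_Re2_Im2 sqr_normc mulrC. Qed.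

Section SesquilinearForm.
Variables (K : rcfType) (n : nat).
Implicit Types (A B : 'M[K[i]]_n) (u v w : 'cV[K[i]]_n).

(** Taking the real part gives values in the ordered field [K] for every matrix; for a hermitian one
    nothing is lost, by [sform_hermitian]. *)
Definition hform A u : K := ReC (sform u (A *m u)).

Definition hermitian A := dagger A = A.

Lemma sformDl u v w : sform (u + v) w = sform u w + sform v w.
Proof.
rewrite /sform -big_split /=; apply: eq_bigr => i _.
by rewrite mxE rmorphD mulrDl.
Qed.

Lemma sformDr u v w : sform u (v + w) = sform u v + sform u w.
Proof.
by rewrite /sform -big_split /=; apply: eq_bigr => i _; rewrite mxE mulrDr.
Qed.

Lemma sformZl c u v : sform (c *: u) v = conjc c * sform u v.
Proof.
rewrite /sform mulr_sumr; apply: eq_bigr => i _.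
by rewrite mxE rmorphM mulrA.
Qed.

Lemma sformZr c u v : sform u (c *: v) = c * sform u v.
Proof.
by rewrite /sform mulr_sumr; apply: eq_bigr => i _; rewrite mxE mulrCA.
Qed.

Lemma sform_mulmxE A u v :
  sform u (A *m v) = \sum_i \sum_j conjc (u i ord0) * A i j * v j ord0.
Proof.
apply: eq_bigr => i _; rewrite mxE mulr_sumr.
by apply: eq_bigr => j _; rewrite mulrA.
Qed.

Lemma conjc_sform A u v :
  hermitian A -> conjc (sform u (A *m v)) = sform v (A *m u).
Proof.
move=> hA; rewrite !sform_mulmxE rmorph_sum exchange_big /=.
apply: eq_bigr => i _; rewrite rmorph_sum; apply: eq_bigr => j _.
rewrite !rmorphM /= conjcK -[in RHS]hA mxE; ring.
Qed.

Lemma sform_hermitian A u : hermitian A -> sform u (A *m u) = (hform A u)%:C.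
Proof.
move=> /(conjc_sform u u); rewrite /hform; case: (sform _ _) => a b /= [bN].
by congr (_ +i* _); lra.
Qed.

Lemma hformD A B u : hform (A + B) u = hform A u + hform B u.
Proof. by rewrite /hform mulmxDl sformDr ReD. Qed.

Lemma hformZ a A u : hform (a%:C *: A) u = a * hform A u.
Proof. by rewrite /hform -scalemxAl sformZr ReMr. Qed.

Lemma hformN A u : hform (- A) u = - hform A u.
Proof. by rewrite -scaleN1r -(rmorphN1 (real_complex K)) hformZ mulN1r. Qed.

Lemma hform_scale A c u :
  hform A (c *: u) = (ReC c ^+ 2 + ImC c ^+ 2) * hform A u.
Proof.
by rewrite /hform -scalemxAr sformZr sformZl mulrA [c * _]mulrC conjc_mulE ReMr.
Qed.

Lemma hform_scaleR A a u : hform A (a%:C *: u) = a ^+ 2 * hform A u.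
Proof. by rewrite hform_scale /= expr0n addr0. Qed.

Lemma hform0 A : hform A 0 = 0.
Proof. by rewrite -(scale0r (0 : 'cV_n)) (hform_scaleR A 0) expr0n mul0r. Qed.

Lemma hform_polar A u v : hermitian A ->
  hform A (u + v) = hform A u + 2 * ReC (sform u (A *m v)) + hform A v.
Proof.
move=> hA; rewrite /hform mulmxDr sformDl !sformDr !ReD.
rewrite -[sform v (A *m u)](conjc_sform _ _ hA) Re_conjc; ring.
Qed.

Lemma hform1E u :
  hform 1%:M u = \sum_i (ReC (u i ord0) ^+ 2 + ImC (u i ord0) ^+ 2).
Proof.
rewrite /hform mul1mx /sform (eq_bigr _ (fun i _ => conjc_mulE _)).
by rewrite -(rmorph_sum (real_complex K)).
Qed.

Lemma hform1_ge0 u : 0 <= hform 1%:M u.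
Proof. by rewrite hform1E sumr_ge0// => i _; rewrite addr_ge0// sqr_ge0. Qed.

Lemma hform1_gt0 u : u != 0 -> 0 < hform 1%:M u.
Proof.
move=> u0; rewrite lt0r hform1_ge0 andbT; apply: contraNneq u0.
rewrite hform1E => /eqP; rewrite psumr_eq0; last first.
  by move=> i _; rewrite addr_ge0// sqr_ge0.
move=> /allP h; apply/eqP/matrixP => i j; rewrite ord1 mxE.
have := h i (mem_index_enum _).
rewrite paddr_eq0 ?sqr_ge0// !sqrf_eq0 => /andP[/eqP r0 /eqP i0].
by apply/eqP; rewrite eq_complex r0 i0 !eqxx.
Qed.

Lemma hermitianD A B : hermitian A -> hermitian B -> hermitian (A + B).
Proof.
by move=> hA hB; apply/matrixP => i j; rewrite -{2}hA -{2}hB !mxE rmorphD.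
Qed.

Lemma hermitianZ a A : hermitian A -> hermitian (a%:C *: A).
Proof.
move=> hA; apply/matrixP => i j; rewrite -{2}hA !mxE.
by rewrite rmorphM [X in X * _]conjc_real.
Qed.

Lemma hermitianN A : hermitian A -> hermitian (- A).
Proof. by rewrite -scaleN1r -(rmorphN1 (real_complex K)); exact: hermitianZ. Qed.

Lemma hermitian1 : hermitian 1%:M.
Proof. by apply/matrixP => i j; rewrite !mxE eq_sym conjc_nat. Qed.

End SesquilinearForm.

(** * Convexity of the joint range of two hermitian forms *)

Section Convexity.
Variables (K : rcfType) (n : nat).
Implicit Types (M N P R : 'M[K[i]]_n) (u v w : 'cV[K[i]]_n).

(** After a change of phase of [v], [R] vanishes on the whole real line [x u + v], while [P]
    restricts to a quadratic in [x] with negative leading and positive constant coefficient, which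
    has a root. *)
Lemma common_isotropic P R u v : hermitian P -> hermitian R ->
  hform R u = 0 -> hform R v = 0 -> hform P u < 0 -> 0 < hform P v ->
  exists w, [/\ w != 0, hform P w = 0 & hform R w = 0].
Proof.
move=> hP hR Ru Rv Pu Pv.
(* The phase [z] removes the cross term of [R]: if that term is [a + b i], then [b + a i] makes the
   product purely imaginary. *)
have [z [z0 Rz]] : exists z : K[i],
    0 < ReC z ^+ 2 + ImC z ^+ 2 /\ ReC (z * sform u (R *m v)) = 0.
  case: (sform u (R *m v)) => a b.
  have [ab0|ab0] := boolP (a ^+ 2 + b ^+ 2 == 0).
    exists 1; split; first by rewrite /= expr1n expr0n addr0.
    move: ab0; rewrite mul1r paddr_eq0 ?sqr_ge0// !sqrf_eq0.
    by case/andP=> /eqP.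
  exists (b +i* a); rewrite /=; split; last by ring.
  by rewrite lt0r addrC ab0 addr_ge0// sqr_ge0.
pose v' := z *: v.
have Pv' : 0 < hform P v' by rewrite hform_scale mulr_gt0.
have Rv' : hform R v' = 0 by rewrite hform_scale Rv mulr0.
have Ruv' : ReC (sform u (R *m v')) = 0 by rewrite -scalemxAr sformZr.
pose d := ReC (sform u (P *m v')).
have [x xE] : exists x, hform P u * x ^+ 2 + 2 * d * x + hform P v' = 0.
  (* The discriminant is nonnegative because the outer coefficients have opposite signs. *)
  have /sqr_sqrtr : 0 <= d ^+ 2 - hform P u * hform P v'.
    by rewrite subr_ge0 (le_trans _ (sqr_ge0 d))// mulr_le0_ge0// ltW.
  set s := Num.sqrt _ => sE.
  have Pu0 : hform P u != 0 by rewrite lt_eqF.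
  exists ((- d - s) / hform P u).
  have -> : hform P v' = (d ^+ 2 - s ^+ 2) / hform P u.
    by rewrite sE; field.
  by field.
have Re_xu A : ReC (sform (x%:C *: u) (A *m v')) = x * ReC (sform u (A *m v')).
  by rewrite sformZl conjc_real ReMr.
exists (x%:C *: u + v'); split.
- apply: contraTneq Pv' => /eqP; rewrite addrC addr_eq0 => /eqP ->.
  rewrite -scaleNr -(rmorphN (real_complex K)) (hform_scaleR P (- x)) sqrrN.
  by rewrite -leNgt mulr_ge0_le0 ?sqr_ge0// ltW.
- by rewrite hform_polar// hform_scaleR Re_xu -/d -xE; ring.
- by rewrite hform_polar// hform_scaleR Re_xu Ruv' Ru Rv' !mulr0 !addr0.
Qed.

(* The Toeplitz-Hausdorff theorem in homogeneous form. *)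
Lemma joint_range_add M N u v : hermitian M -> hermitian N ->
  exists w, [/\ hform 1%:M w = hform 1%:M u + hform 1%:M v,
    hform M w = hform M u + hform M v & hform N w = hform N u + hform N v].
Proof.
move=> hM hN.
have [->|u0] := eqVneq u 0; first by exists v; rewrite !hform0 !add0r.
set q := hform 1%:M u + hform 1%:M v.
have q0 : 0 < q by rewrite ltr_wpDr ?hform1_ge0// hform1_gt0.
set m := hform M u + hform M v; set k := hform N u + hform N v.
(* The shifts turn the problem into finding a common isotropic vector: such a vector has the ratios
   [m / q] and [k / q], and rescaling it to square norm [q] gives the required values. *)
pose M' := M + (- (m / q))%:C *: 1%:M; pose N' := N + (- (k / q))%:C *: 1%:M.
have M'E w : hform M' w = hform M w - m / q * hform 1%:M w.
  by rewrite hformD (hformZ (- (m / q))) mulNr.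
have N'E w : hform N' w = hform N w - k / q * hform 1%:M w.
  by rewrite hformD (hformZ (- (k / q))) mulNr.
have hM' : hermitian M' by apply/hermitianD/hermitianZ/hermitian1.
have hN' : hermitian N' by apply/hermitianD/hermitianZ/hermitian1.
suff [w [w0 Mw Nw]] : exists w, [/\ w != 0, hform M' w = 0 & hform N' w = 0].
  have nw := hform1_gt0 w0.
  have sE : Num.sqrt (q / hform 1%:M w) ^+ 2 = q / hform 1%:M w.
    by rewrite sqr_sqrtr// divr_ge0 ?hform1_ge0// ltW.
  exists ((Num.sqrt (q / hform 1%:M w))%:C *: w).
  rewrite !hform_scaleR sE divfK ?gt_eqF//; split=> //.
    move: Mw; rewrite M'E => /eqP; rewrite subr_eq0 => /eqP ->.
    by field; rewrite !gt_eqF.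
  move: Nw; rewrite N'E => /eqP; rewrite subr_eq0 => /eqP ->.
  by field; rewrite !gt_eqF.
have Mv : hform M' v = - hform M' u.
  by rewrite !M'E /m /q; field; rewrite gt_eqF.
have Nv : hform N' v = - hform N' u.
  by rewrite !N'E /k /q; field; rewrite gt_eqF.
clearbody M' N'; move Mu : (hform M' u) Mv => a Mv.
move Nu : (hform N' u) Nv => b Nv.
have [|ab0] := boolP (a ^+ 2 + b ^+ 2 == 0).
  rewrite paddr_eq0 ?sqr_ge0// !sqrf_eq0 => /andP[/eqP a0 /eqP b0].
  by exists u; rewrite Mu Nu.
have {}ab0 : 0 < a ^+ 2 + b ^+ 2 by rewrite lt0r ab0 addr_ge0// sqr_ge0.
(* The shifted values at [u] and [v] are [(a, b)] and [(-a, -b)]. In these rotated coordinates [R]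
   vanishes at both, and [P] takes opposite signs. *)
pose P := a%:C *: M' + b%:C *: N'; pose R := b%:C *: M' + (- a)%:C *: N'.
have PE w : hform P w = a * hform M' w + b * hform N' w.
  by rewrite hformD !hformZ.
have RE w : hform R w = b * hform M' w - a * hform N' w.
  by rewrite hformD !hformZ mulNr.
have hP : hermitian P by apply: hermitianD; apply: hermitianZ.
have hR : hermitian R by apply: hermitianD; apply: hermitianZ.
have [||||w [w0 Pw Rw]] := common_isotropic (u := v) (v := u) hP hR.
- by rewrite RE Mv Nv; ring.
- by rewrite RE Mu Nu; ring.
- rewrite PE Mv Nv (_ : _ + _ = - (a ^+ 2 + b ^+ 2)) ?oppr_lt0//; ring.
- by rewrite PE Mu Nu -!expr2.
move: Pw Rw; rewrite PE RE => Pw Rw; exists w; split=> //.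
- apply: (mulfI (lt0r_neq0 ab0)); rewrite mulr0.
  transitivity (a * (a * hform M' w + b * hform N' w)
                + b * (b * hform M' w - a * hform N' w)); first by ring.
  by rewrite Pw Rw !mulr0 addr0.
- apply: (mulfI (lt0r_neq0 ab0)); rewrite mulr0.
  transitivity (b * (a * hform M' w + b * hform N' w)
                - a * (b * hform M' w - a * hform N' w)); first by ring.
  by rewrite Pw Rw !mulr0 subr0.
Qed.

End Convexity.

(** * Polynomial families, Lagrange reduction and germs of definite forms *)

Section PolynomialFamilies.
Variable K : rcfType.

Definition poly_fun (f : K -> K[i]) :=
  exists p : {poly K[i]}, forall s, f s = p.[s%:C].

Definition poly_mx m n (A : K -> 'M[K[i]]_(m, n)) :=
  forall i j, poly_fun (fun s => A s i j).

Lemma poly_fun_cst c : poly_fun (fun=> c).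
Proof. by exists c%:P => s; rewrite hornerC. Qed.

Lemma poly_fun_id : poly_fun (real_complex K).
Proof. by exists 'X => s; rewrite hornerX. Qed.

Lemma poly_funD f g : poly_fun f -> poly_fun g -> poly_fun (fun s => f s + g s).
Proof. by move=> [p pE] [q qE]; exists (p + q) => s; rewrite hornerD pE qE. Qed.

Lemma poly_funN f : poly_fun f -> poly_fun (fun s => - f s).
Proof. by move=> [p pE]; exists (- p) => s; rewrite hornerN pE. Qed.

Lemma poly_funM f g : poly_fun f -> poly_fun g -> poly_fun (fun s => f s * g s).
Proof. by move=> [p pE] [q qE]; exists (p * q) => s; rewrite hornerM pE qE. Qed.

(** The parameter is real, so conjugation acts on the coefficients alone. *)
Lemma poly_fun_conjc f : poly_fun f -> poly_fun (fun s => conjc (f s)).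
Proof.
move=> [p pE]; exists (map_poly conjc p) => s.
by rewrite -[X in _.[X]]conjc_real horner_map pE.
Qed.

Lemma poly_fun_sum (I : Type) (r : seq I) (f : I -> K -> K[i]) :
  (forall i, poly_fun (f i)) -> poly_fun (fun s => \sum_(i <- r) f i s).
Proof.
move=> fP; elim: r => [|i r IHr].
  by exists 0 => s; rewrite big_nil horner0.
by have [p pE] := poly_funD (fP i) IHr; exists p => s; rewrite big_cons -pE.
Qed.

Lemma Re_poly_fun f : poly_fun f ->
  exists p : {poly K}, forall s, ReC (f s) = p.[s].
Proof.
move=> [p pE]; exists (map_poly ReC p) => s; rewrite pE.
elim/poly_ind: p {pE} => [|p c IHp]; first by rewrite map_poly0 !horner0.
have -> : map_poly ReC (p * 'X + c%:P) = map_poly ReC p * 'X + (ReC c)%:P.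
  apply/polyP => k; rewrite coef_map_id0// !coefD !coefMX !coefC.
  by rewrite ReD coef_map_id0//; case: eqP.
by rewrite !hornerMXaddC ReD [_ * s%:C]mulrC ReMr IHp mulrC.
Qed.

Lemma poly_fun_sform n (A : K -> 'M[K[i]]_n) (v w : K -> 'cV[K[i]]_n) :
  poly_mx A -> poly_mx v -> poly_mx w ->
  poly_fun (fun s => sform (v s) (A s *m w s)).
Proof.
move=> hA hv hw.
suff [p pE] : poly_fun (fun s => \sum_i \sum_j
    conjc (v s i ord0) * A s i j * w s j ord0).
  by exists p => s; rewrite sform_mulmxE pE.
do 2!apply: poly_fun_sum => ?.
by do !apply: poly_funM => //; apply: poly_fun_conjc.
Qed.

Lemma poly_hform n (A : K -> 'M[K[i]]_n) (w : K -> 'cV[K[i]]_n) :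
  poly_mx A -> poly_mx w ->
  exists p : {poly K}, forall s, hform (A s) (w s) = p.[s].
Proof. by move=> hA hw; apply/Re_poly_fun/poly_fun_sform. Qed.

Lemma poly_mx_cst m n (A : 'M[K[i]]_(m, n)) : poly_mx (fun=> A).
Proof. by move=> i j; apply: poly_fun_cst. Qed.

Lemma poly_mx_pencil n (A B : 'M[K[i]]_n) : poly_mx (fun s => A + s%:C *: B).
Proof.
move=> i j; have [p pE] := poly_funD (poly_fun_cst (A i j))
  (poly_funM poly_fun_id (poly_fun_cst (B i j))).
by exists p => s; rewrite !mxE pE.
Qed.

(* Lagrange reduction, with denominators cleared so that it preserves
   polynomial dependence on a parameter. *)
Definition schur n (A : 'M[K[i]]_n.+1) : 'M[K[i]]_n :=
  \matrix_(i, j) (A ord0 ord0 * A (lift ord0 i) (lift ord0 j)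
                  - A (lift ord0 i) ord0 * A ord0 (lift ord0 j)).

Definition tail n (u : 'cV[K[i]]_n.+1) : 'cV[K[i]]_n :=
  \col_i u (lift ord0 i) ord0.

(** Completing the square in the first coordinate, multiplied through by the corner entry: the
    square is that of the first entry of [A *m u], and the remainder involves only the other
    coordinates. *)
Lemma schurE n (A : 'M[K[i]]_n.+1) (u : 'cV[K[i]]_n.+1) : hermitian A ->
  A ord0 ord0 * sform u (A *m u) =
  conjc ((A *m u) ord0 ord0) * (A *m u) ord0 ord0
  + sform (tail u) (schur A *m tail u).
Proof.
move=> hA.
have hAE i j : conjc (A i j) = A j i by rewrite -[in RHS]hA mxE.
pose x := u ord0 ord0; pose a := A ord0 ord0.
pose L := \sum_j A ord0 (lift ord0 j) * u (lift ord0 j) ord0.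
pose L' := \sum_i conjc (u (lift ord0 i) ord0) * A (lift ord0 i) ord0.
pose T := \sum_i \sum_j conjc (u (lift ord0 i) ord0)
  * A (lift ord0 i) (lift ord0 j) * u (lift ord0 j) ord0.
have yE : (A *m u) ord0 ord0 = a * x + L by rewrite mxE big_ord_recl.
have LE : conjc L = L'.
  rewrite rmorph_sum; apply: eq_bigr => i _.
  by rewrite rmorphM /= hAE mulrC.
have -> : sform (tail u) (schur A *m tail u) = a * T - L' * L.
  rewrite sform_mulmxE [a * T]mulr_sumr [L' * L]mulr_suml -sumrB.
  apply: eq_bigr => i _; rewrite /L !mulr_sumr -sumrB.
  by apply: eq_bigr => j _; rewrite !mxE /a; ring.
have -> : sform u (A *m u) = conjc x * (a * x + L) + L' * x + T.
  rewrite sform_mulmxE big_ord_recl big_ord_recl -/x -/a.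
  rewrite [X in _ + X](eq_bigr (fun i =>
    conjc (u (lift ord0 i) ord0) * A (lift ord0 i) ord0 * x
    + \sum_j conjc (u (lift ord0 i) ord0)
      * A (lift ord0 i) (lift ord0 j) * u (lift ord0 j) ord0)); last first.
    by move=> i _; rewrite big_ord_recl.
  rewrite big_split /= -mulr_suml -/L' -/T mulrDr /L mulr_sumr addrA.
  by rewrite -!addrA mulrA; congr (_ + (_ + _));
    apply: eq_bigr => j _; rewrite mulrA.
by rewrite yE rmorphD rmorphM /= LE (hAE ord0 ord0) -/a -/x; ring.
Qed.

Lemma hermitian_schur n (A : 'M[K[i]]_n.+1) : hermitian A -> hermitian (schur A).
Proof.
move=> hA; have hAE i j : conjc (A i j) = A j i by rewrite -[in RHS]hA mxE.
apply/matrixP => i j; rewrite !mxE rmorphB !rmorphM /= !hAE.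
by rewrite [A ord0 (lift _ _) * _]mulrC.
Qed.

Lemma hform_schur n (A : 'M[K[i]]_n.+1) (u : 'cV[K[i]]_n.+1) : hermitian A ->
  ReC (A ord0 ord0) * hform A u =
  ReC ((A *m u) ord0 ord0) ^+ 2 + ImC ((A *m u) ord0 ord0) ^+ 2
  + hform (schur A) (tail u).
Proof.
move=> hA; have := schurE u hA; rewrite conjc_mulE.
rewrite (sform_hermitian u hA) (sform_hermitian _ (hermitian_schur hA)).
move=> /(congr1 ReC); rewrite ReD /= => <-.
by case: (A ord0 ord0) => ? ? /=; rewrite mulr0 subr0.
Qed.

(** Induction on the size. The constant family at the first basis vector makes the corner entry
    positive, the reduced matrix inherits the hypothesis on polynomial families, and completing the
    square carries its positivity back to [A]. *)
Lemma eventually_posdef (F : set_system K) (FF : Filter F) n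
    (A : K -> 'M[K[i]]_n) :
  poly_mx A -> (forall s, hermitian (A s)) ->
  (forall w : K -> 'cV[K[i]]_n, poly_mx w -> (\forall s \near F, w s != 0) ->
    \forall s \near F, 0 < hform (A s) (w s)) ->
  \forall s \near F, forall u, u != 0 -> 0 < hform (A s) u.
Proof.
elim: n A => [|n IHn] A pA hA Apos.
  by apply: filterE => s u; rewrite [u]flatmx0 eqxx.
have A00 : \forall s \near F, 0 < ReC (A s ord0 ord0).
  pose e : 'cV[K[i]]_n.+1 := delta_mx ord0 ord0.
  have e0 : e != 0.
    apply/eqP => /matrixP/(_ ord0 ord0) /eqP.
    by rewrite !mxE !eqxx oner_eq0.
  have epos : \forall s \near F, 0 < hform (A s) e.
    by apply: (Apos (fun=> e) (poly_mx_cst e)); apply: filterE.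
  apply: filterS epos => s; rewrite /hform /sform -colE big_ord_recl big1 ?addr0.
    by rewrite !mxE !eqxx conjc1 mul1r.
  by move=> i _; rewrite !mxE eq_sym conjc0 mul0r.
have pS : poly_mx (fun s => schur (A s)).
  move=> i j; have [p pE] := poly_funD (poly_funM (pA ord0 ord0)
    (pA (lift ord0 i) (lift ord0 j))) (poly_funN (poly_funM
    (pA (lift ord0 i) ord0) (pA ord0 (lift ord0 j)))).
  by exists p => s; rewrite -pE mxE.
have Spos : \forall s \near F, forall u, u != 0 -> 0 < hform (schur (A s)) u.
  apply: IHn => // [s|w pw w0]; first exact: hermitian_schur.
  (* lift [w] to the vector whose image under [A] has zero first entry *)
  pose v s : 'cV[K[i]]_n.+1 := \col_i
    match unlift ord0 i with
    | None => - \sum_j A s ord0 (lift ord0 j) * w s j ord0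
    | Some j => A s ord0 ord0 * w s j ord0
    end.
  have tv s : tail (v s) = A s ord0 ord0 *: w s.
    by apply/matrixP => i j; rewrite [j]ord1 !mxE liftK.
  have Av s : (A s *m v s) ord0 ord0 = 0.
    rewrite mxE big_ord_recl !mxE unlift_none mulrN mulr_sumr -sumrN -big_split.
    by rewrite big1// => i _; rewrite !mxE liftK /=; ring.
  have pv : poly_mx v.
    move=> i j; rewrite [j]ord1; case: (unliftP ord0 i) => [k|] ->.
      have [p pE] := poly_funM (pA ord0 ord0) (pw k ord0).
      by exists p => s; rewrite mxE liftK pE.
    have [p pE] := poly_funN (poly_fun_sum (index_enum 'I_n) (fun j =>
      poly_funM (pA ord0 (lift ord0 j)) (pw j ord0))).
    by exists p => s; rewrite mxE unlift_none -pE.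
  have v0 : \forall s \near F, v s != 0.
    move: A00 w0; apply: filterS2 => s A0; apply: contraNneq => v0.
    have := tv s; rewrite v0 => /esym/eqP.
    have -> : tail (0 : 'cV[K[i]]_n.+1) = 0 by apply/matrixP => i j; rewrite !mxE.
    rewrite scaler_eq0 => /orP[/eqP A0'|//].
    by move: A0; rewrite A0' ltxx.
  (* On [v] the square vanishes by [Av], so the positive value of [A] there is, up to positive
     factors, the value of the reduced form at [w]. *)
  move: A00 (Apos _ pv v0); apply: filterS2 => s A0 /(mulr_gt0 A0).
  rewrite hform_schur// Av tv /= expr0n /= !add0r hform_scale.
  rewrite pmulr_rgt0// ltr_wpDr ?sqr_ge0//.
  by rewrite exprn_gt0.
move: A00 Spos; apply: filterS2 => s A0 Spos u u0.
rewrite -(pmulr_rgt0 _ A0) hform_schur//.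
(* If the tail is zero, only the square is left, and it is nonzero because both the corner and the
   first coordinate are. *)
have [t0|t0] := eqVneq (tail u) 0; last first.
  by rewrite ltr_wpDl ?Spos// addr_ge0 ?sqr_ge0.
rewrite t0 hform0 addr0.
have uE i : u (lift ord0 i) ord0 = 0.
  by have /matrixP/(_ i ord0) := t0; rewrite !mxE.
have x0 : u ord0 ord0 != 0.
  apply: contraNneq u0 => x0; apply/eqP/matrixP => i j.
  by rewrite [j]ord1 mxE; case: (unliftP ord0 i) => [k|] ->.
rewrite mxE big_ord_recl big1 ?addr0; last by move=> i _; rewrite uE mulr0.
have : A s ord0 ord0 * u ord0 ord0 != 0.
  by rewrite mulf_neq0//; apply: contraTneq A0 => ->; rewrite ltxx.
case: (_ * _) => a b; rewrite eq_complex /= => ab0.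
rewrite lt0r addr_ge0 ?sqr_ge0// andbT.
by rewrite paddr_eq0 ?sqr_ge0// !sqrf_eq0.
Qed.

End PolynomialFamilies.

(** * Perturbation of semidefinite forms, and signs of polynomials near a cut *)

Section DefinitePencils.
Variables (K : rcfType) (n : nat).
Implicit Types (A B M N : 'M[K[i]]_n) (u v w : 'cV[K[i]]_n).

Lemma joint_range_cone M N u v (a b : K) : hermitian M -> hermitian N ->
  0 <= a -> 0 <= b ->
  exists w, [/\ hform 1%:M w = a * hform 1%:M u + b * hform 1%:M v,
    hform M w = a * hform M u + b * hform M v &
    hform N w = a * hform N u + b * hform N v].
Proof.
move=> hM hN a0 b0.
have [w] := joint_range_add ((Num.sqrt a)%:C *: u) ((Num.sqrt b)%:C *: v) hM hN.
by rewrite !hform_scaleR !sqr_sqrtr// => wE; exists w.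
Qed.

Lemma near_at_right_horner_gt0 (p : {poly K}) :
  0 < p.[0] -> \forall s \near 0^'+, 0 < p.[s].
Proof.
move=> p0; have [d d0 dp] := poly_cont 0 p p0.
near=> s.
have : `|s - 0| < d.
  rewrite subr0 gtr0_norm; last by near: s; exact: nbhs_right_gt.
  by near: s; exact: nbhs_right_lt.
by move=> /dp; rewrite ltr_norml => /andP[]; lra.
Unshelve. all: by end_near. Qed.

(** Dividing out the largest power of [s] common to all entries leaves a family with a nonzero value
    at 0, which governs its germ there. *)
Lemma poly_mx_factor (w : K -> 'cV[K[i]]_n) : poly_mx w ->
  (exists s, w s != 0) ->
  exists k (w' : K -> 'cV[K[i]]_n),
    [/\ poly_mx w', w' 0 != 0 & forall s, w s = (s ^+ k)%:C *: w' s].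
Proof.
move=> pw [s0 ws0].
have /choice[P PE] : forall i, exists p : {poly K[i]},
  forall s, w s i ord0 = p.[s%:C] by move=> i; apply: pw.
have exk : exists k, [exists i, (P i)`_k != 0].
  apply: contra_neqP ws0 => noP; apply/matrixP => i j; rewrite [j]ord1 mxE PE.
  suff -> : P i = 0 by rewrite horner0.
  apply/polyP => k; rewrite coef0; apply: contra_notP noP => /eqP Pik.
  by exists k; apply/existsP; exists i.
case: (ex_minnP exk) => k /existsP[i Pik] kmin.
exists k, (fun s => \col_i (drop_poly k (P i)).[s%:C]); split.
- move=> l j; exists (drop_poly k (P l)) => s; rewrite mxE//.
- apply: contraNneq Pik => /matrixP/(_ i ord0); rewrite !mxE.
  by rewrite horner_coef0 coef_drop_poly => ->.
- move=> s; apply/matrixP => l j; rewrite [j]ord1 !mxE PE.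
  rewrite -{1}(poly_take_drop k (P l)) hornerD hornerM hornerXn.
  rewrite rmorphXn mulrC (_ : take_poly k _ = 0) ?horner0 ?add0r//.
  apply/polyP => j'; rewrite coef_take_poly coef0; case: ltnP => // ltj.
  apply: contraTeq ltj => Plj; rewrite -leqNgt kmin//.
  by apply/existsP; exists l.
Qed.

(** [eventually_posdef] applied to [A + s B] at 0+. After a power of [s] is factored out of a test
    family, its value at 0 decides: either [A] is already positive there, or [A] vanishes and [B] is
    positive. *)
Lemma psd_perturbation A B : hermitian A -> hermitian B ->
  (forall u, 0 <= hform A u) ->
  (forall u, u != 0 -> hform A u = 0 -> 0 < hform B u) ->
  exists2 e, 0 < e & forall u, u != 0 -> 0 < hform A u + e * hform B u.
Proof.
move=> hA hB A0 B0.
have FF : ProperFilter (0^'+ : set_system K) by exact: at_right_proper_filter.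
have pos (w : K -> 'cV[K[i]]_n) : poly_mx w -> (\forall s \near 0^'+, w s != 0) ->
    \forall s \near 0^'+, 0 < hform (A + s%:C *: B) (w s).
  move=> pw /(@filter_ex _ _ FF)/(poly_mx_factor pw)[k [w' [pw' w'0 wE]]].
  suff pos' : \forall s \near 0^'+, 0 < hform (A + s%:C *: B) (w' s).
    near=> s; rewrite wE hform_scaleR mulr_gt0//; last by near: s.
    by rewrite !exprn_gt0//; near: s; exact: nbhs_right_gt.
  (* If [A] vanishes at [w' 0], it may still be nonzero at nearby [w' s], but it is never negative,
     so the positive term in [B] suffices. *)
  have [Aw0|Aw0] := eqVneq (hform A (w' 0)) 0.
    have [q qE] := poly_hform (poly_mx_cst B) pw'.
    have q0 : 0 < q.[0] by rewrite -qE B0.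
    near=> s; rewrite hformD hformZ ltr_wpDl// mulr_gt0//.
    by rewrite qE; near: s; exact: near_at_right_horner_gt0.
  have [q qE] := poly_hform (poly_mx_pencil A B) pw'.
  have q0 : 0 < q.[0].
    by rewrite -qE hformD hformZ mul0r addr0 lt0r Aw0 A0.
  by near=> s; rewrite qE; near: s; exact: near_at_right_horner_gt0.
have herm s : hermitian (A + s%:C *: B) by apply/hermitianD/hermitianZ.
have posdef := eventually_posdef _ (poly_mx_pencil A B) herm pos.
have /(@filter_ex _ _ FF)[e [e0 epos]] : \forall e \near 0^'+,
    0 < e /\ forall u, u != 0 -> 0 < hform (A + e%:C *: B) u.
  by near=> e; split; near: e; [exact: nbhs_right_gt|exact: posdef].
by exists e => // u /epos; rewrite hformD hformZ.
Unshelve. all: by end_near. Qed.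

(** A nonzero polynomial has finitely many roots and [F] avoids each of them, so some closed
    interval in [F] contains no root; the intermediate value theorem fixes the sign on it. *)
Lemma cut_sign (F : set_system K) (FF : ProperFilter F) (p : {poly K}) :
  (forall X, F X -> exists a b, F [set s | a <= s <= b] /\
    (forall s, a <= s <= b -> X s)) ->
  (forall c, \forall s \near F, s != c) ->
  [\/ \forall s \near F, 0 < p.[s], \forall s \near F, p.[s] < 0
    | \forall s \near F, p.[s] = 0].
Proof.
move=> Fitv Fpt.
have [->|p0] := eqVneq p 0.
  by constructor 3; apply: filterE => s; rewrite horner0.
have noroot : \forall s \near F, ~~ root p s.
  have [r rE] : exists r : seq K, forall x, root p x -> x \in r.
    by exists (rootsR p) => x px; rewrite -(roots_on_rootsR p0) px.
  suff : \forall s \near F, s \notin r.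
    by apply: filterS => s; apply: contra; apply: rE.
  elim: r {rE} => [|c r IHr]; first exact: filterE.
  by apply: filterS2 (Fpt c) IHr => s sc sr; rewrite inE negb_or sc.
have [a [b [Fab nor]]] := Fitv _ noroot.
have {}nor : {in `[a, b], forall x, ~~ root p x}.
  by move=> x; rewrite in_itv; apply: nor.
have /= same := noroot_noivt nor.
have [c /= cab] := filter_ex Fab.
have : p.[c] != 0 by exact: nor.
rewrite neq_lt => /orP[pc|pc]; [constructor 2|constructor 1];
  apply: filterS Fab => x /= xab;
  have := same _ _ cab xab; nra.
Qed.

End DefinitePencils.

(** * Existence of a definite combination *)

Section SeparatingPencil.
Variables (K : rcfType) (n : nat).
Implicit Types (M N : 'M[K[i]]_n) (u v w : 'cV[K[i]]_n).

Definition anisotropic_pair M N :=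
  forall u, hform M u = 0 -> hform N u = 0 -> u = 0.

(* If every member of the pencil takes a negative value, each [M - s N] has
   isotropic vectors, and the sign of [N] on them cuts [K] into [T < S] without
   endpoints. The signs of polynomials are constant near this cut, whereas [N]
   changes sign there on the isotropic vectors. *)
Lemma indefinite_pencil_false M N x : hermitian M -> hermitian N ->
  anisotropic_pair M N ->
  (forall c s, (c != 0) || (s != 0) ->
    exists u, c * hform M u + s * hform N u < 0) ->
  0 < hform M x -> hform N x = 0 -> False.
Proof.
move=> hM hN aniso neg Mx Nx.
pose S s := exists2 u, 0 < hform N u & hform M u = s * hform N u.
pose T s := exists2 u, hform N u < 0 & hform M u = s * hform N u.
have gt0_neq0 w : 0 < hform 1%:M w -> w != 0.
  by apply: contraTneq => ->; rewrite hform0 ltxx.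
have pos c s : (c != 0) || (s != 0) -> exists u, 0 < c * hform M u + s * hform N u.
  rewrite -oppr_eq0 -(oppr_eq0 s) => /neg[u]; rewrite !mulNr -opprD oppr_lt0.
  by exists u.
have negQ s : exists u, hform M u - s * hform N u < 0.
  by have [|u] := neg 1 (- s); rewrite ?oner_eq0// mul1r mulNr; exists u.
have posQ s : exists u, 0 < hform M u - s * hform N u.
  by have [|u] := pos 1 (- s); rewrite ?oner_eq0// mul1r mulNr; exists u.
(* The weights cancel [M - s N]. They are explicit so that for polynomial families of [u] and [v]
   the resulting value of [N] is again polynomial in [s]. *)
have mix s u v : hform M u - s * hform N u < 0 -> 0 < hform M v - s * hform N v ->
    exists w, [/\ w != 0, hform M w = s * hform N w & hform N w =
      (hform M v - s * hform N v) * hform N u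
      - (hform M u - s * hform N u) * hform N v].
  move=> Qu Qv; have u0 : u != 0.
    by apply: contraTneq Qu => ->; rewrite !hform0 mulr0 subr0 ltxx.
  have [||w [w1 Mw Nw]] := joint_range_cone u v hM hN
    (a := hform M v - s * hform N v) (b := - (hform M u - s * hform N u)).
  - exact: ltW.
  - by rewrite oppr_ge0 ltW.
  exists w; rewrite mulNr in Nw; split => //; last by rewrite Mw Nw; ring.
  apply: gt0_neq0; rewrite w1 ltr_wpDr ?mulr_gt0 ?hform1_gt0//.
  by rewrite mulr_ge0 ?hform1_ge0// oppr_ge0 ltW.
have iso_side s w : w != 0 -> hform M w = s * hform N w ->
    (0 < hform N w /\ S s) \/ (hform N w < 0 /\ T s).
  move=> w0 Mw; case: (ltgtP (hform N w) 0) => Nw.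
  - by right; split=> //; exists w.
  - by left; split=> //; exists w.
  - by case/eqP: w0; apply: aniso => //; rewrite Mw Nw mulr0.
have cover s : S s \/ T s.
  have [u Qu] := negQ s; have [v Qv] := posQ s.
  have [w [w0 Mw _]] := mix s u v Qu Qv.
  by case: (iso_side s w w0 Mw) => -[_]; [left|right].
(* If [s <= t], combining [u] and [v] so as to cancel [N] makes [M] nonpositive; adding a multiple
   of [x] to the mixture cancels [M] too, which gives a nonzero common isotropic vector. *)
have ltTS t s : T t -> S s -> t < s.
  move=> [v Nv Mv] [u Nu Mu]; rewrite ltNge; apply/negP => st.
  have [||w [w1 Mw Nw]] := joint_range_cone u v hM hN
    (a := - hform N v) (b := hform N u); [by rewrite oppr_ge0 ltW|exact: ltW|].
  have [||y [y1 My Ny]] := joint_range_cone w x hM hN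
    (a := hform M x) (b := - hform M w); [exact: ltW| |].
    rewrite Mw Mu Mv (_ : - _ = (t - s) * (hform N u * - hform N v)); last by ring.
    by rewrite mulr_ge0 ?subr_ge0// mulr_ge0 ?oppr_ge0 ?ltW.
  have y0 : y = 0 by apply: aniso; rewrite ?My ?Ny ?Nx ?Nw; ring.
  have u0 : u != 0 by apply: contraTneq Nu => ->; rewrite hform0 ltxx.
  have w0 : 0 < hform 1%:M w.
    rewrite w1 ltr_wpDr//; first by rewrite mulr_ge0 ?hform1_ge0// ltW.
    by rewrite mulr_gt0 ?oppr_gt0 ?hform1_gt0.
  move: y1; rewrite y0 hform0 => /esym/eqP; rewrite gt_eqF//.
  rewrite ltr_wpDr//; last by rewrite mulr_gt0.
  rewrite mulr_ge0 ?hform1_ge0// Mw Mu Mv.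
  rewrite (_ : - _ = (t - s) * (hform N u * - hform N v)); last by ring.
  by rewrite mulr_ge0 ?subr_ge0// mulr_ge0 ?oppr_ge0 ?ltW.
have Sopen s : S s -> exists2 s', s' < s & S s'.
  move=> [u Nu Mu]; have [y Qy] := negQ s.
  (* This [e] satisfies [e |N y| < N u], so [N] stays positive, while the negative value of
     [M - s N] at [y] pushes the ratio below [s]. *)
  pose e := hform N u / (1 + `|hform N y|).
  have d0 : 0 < 1 + `|hform N y| by rewrite ltr_pwDl.
  have e0 : 0 < e by rewrite divr_gt0.
  have [||w [_ Mw Nw]] := joint_range_cone u y hM hN (a := 1) (b := e) => //.
    exact: ltW.
  have Nw0 : 0 < hform N w.
    rewrite Nw mul1r -(@ltr_pM2r _ (1 + `|hform N y|))// mul0r mulrDl.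
    rewrite mulrAC divfK ?gt_eqF// -mulrDr mulr_gt0//.
    by have := ler_norm (- hform N y); rewrite normrN; lra.
  exists (hform M w / hform N w); last by exists w; rewrite ?divfK ?gt_eqF.
  rewrite ltr_pdivrMr// -subr_lt0 Mw Nw Mu.
  rewrite (_ : _ - _ = e * (hform M y - s * hform N y)); last by ring.
  by rewrite pmulr_rlt0.
have Topen t : T t -> exists2 t', t < t' & T t'.
  move=> [u Nu Mu]; have [y Qy] := negQ t.
  pose e := - hform N u / (1 + `|hform N y|).
  have d0 : 0 < 1 + `|hform N y| by rewrite ltr_pwDl.
  have e0 : 0 < e by rewrite divr_gt0// oppr_gt0.
  have [||w [_ Mw Nw]] := joint_range_cone u y hM hN (a := 1) (b := e) => //.
    exact: ltW.
  have Nw0 : hform N w < 0.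
    rewrite Nw mul1r -(@ltr_pM2r _ (1 + `|hform N y|))// mul0r mulrDl.
    rewrite mulrAC divfK ?gt_eqF// mulNr -mulrBr nmulr_rlt0//.
    by have := ler_norm (hform N y); lra.
  exists (hform M w / hform N w); last by exists w; rewrite ?divfK ?lt_eqF.
  rewrite ltr_ndivlMr// -subr_lt0 Mw Nw Mu.
  rewrite (_ : _ - _ = e * (hform M y - t * hform N y)); last by ring.
  by rewrite pmulr_rlt0.
have [t0 Tt0] : exists t, T t.
  have [|u] := neg 0 1; first by rewrite oner_eq0 orbT.
  rewrite mul0r add0r mul1r => Nu.
  by exists (hform M u / hform N u), u; rewrite ?divfK ?lt_eqF.
have [s0 Ss0] : exists s, S s.
  have [|u] := pos 0 1; first by rewrite oner_eq0 orbT.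
  rewrite mul0r add0r mul1r => Nu.
  by exists (hform M u / hform N u), u; rewrite ?divfK ?gt_eqF.
(* The neighbourhoods of the gap: sets containing an interval from a point of [T] to a point of
   [S]. *)
pose F : set_system K := [set X | exists t s,
  [/\ T t, S s & forall z, t <= z <= s -> X z]].
have FF : ProperFilter F.
  split.
    move=> [t [s [Tt Ss]]] /(_ t); apply.
    by rewrite lexx ltW// ltTS.
  split.
  - by exists t0, s0.
  - move=> X Y [t [s [Tt Ss X_]]] [t' [s' [Tt' Ss' Y_]]].
    exists (Num.max t t'), (Num.min s s'); split.
    + by case: leP.
    + by case: leP.
    + move=> z; rewrite ge_max le_min => /andP[/andP[? ?] /andP[? ?]].
      by split; [apply: X_|apply: Y_]; apply/andP.
  - move=> X Y XY [t [s [Tt Ss X_]]]; exists t, s; split=> // z /X_; exact: XY.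
have Fsign p : [\/ \forall s \near F, 0 < p.[s], \forall s \near F, p.[s] < 0
    | \forall s \near F, p.[s] = 0].
  apply: cut_sign => [X [t [s [Tt Ss Xts]]]|c].
    by exists t, s; split=> //; exists t, s.
  case: (cover c) => [/Sopen[s sc Ss]|/Topen[t ct Tt]].
    exists t0, s; split=> // z /andP[_ zs].
    by rewrite lt_eqF// (le_lt_trans zs).
  exists t, s0; split=> // z /andP[tz _].
  by rewrite gt_eqF// (lt_le_trans ct).
(* A polynomial that gives [N] on isotropic vectors has constant sign near the gap, yet it must be
   negative at points of [T] and positive at points of [S]. *)
have no_family p : (\forall s \near F, exists y,
    [/\ y != 0, hform M y = s * hform N y & hform N y = p.[s]]) -> False.
  move=> Fy; have [Fp|Fp|Fp] := Fsign p.
  - have [t [s [Tt Ss /(_ t)]]] := filterI Fy Fp.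
    rewrite lexx ltW ?ltTS// => /(_ isT)[[y [y0 My Ny]] /= pt].
    case: (iso_side t y y0 My) => -[Ny']; first by move=> /(ltTS _ _ Tt); rewrite ltxx.
    by move: pt; rewrite -Ny ltNge ltW.
  - have [t [s [Tt Ss /(_ s)]]] := filterI Fy Fp.
    rewrite lexx ltW ?ltTS// => /(_ isT)[[y [y0 My Ny]] /= ps].
    case: (iso_side s y y0 My) => -[Ny']; last by move=> /ltTS/(_ Ss); rewrite ltxx.
    by move: ps; rewrite -Ny ltNge ltW.
  - have [s [[y [y0 My Ny]] /= ps]] := filter_ex (filterI Fy Fp).
    by case: (iso_side s y y0 My) => -[]; rewrite Ny ps ltxx.
pose Q s := M + s%:C *: (- N).
have QE s u : hform (Q s) u = hform M u - s * hform N u.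
  by rewrite hformD (hformZ s) hformN mulrN.
have hQ s : hermitian (Q s) by apply/hermitianD/hermitianZ/hermitianN.
have pQ : poly_mx Q by exact: poly_mx_pencil.
have Fdecide (w : K -> 'cV[K[i]]_n) : poly_mx w -> (\forall s \near F, w s != 0) ->
    (\forall s \near F, 0 < hform (Q s) (w s)) \/
    (\forall s \near F, hform (Q s) (w s) < 0).
  move=> pw w0; have [p pE] := poly_hform pQ pw.
  have [Fp|Fp|Fp] := Fsign p.
  - by left; apply: filterS Fp => s; rewrite pE.
  - by right; apply: filterS Fp => s; rewrite pE.
  have [q qE] := poly_hform (poly_mx_cst N) pw.
  case: (no_family q); apply: filterS2 w0 Fp => s ws0 ps0.
  exists (w s); split=> //; apply/eqP.
  by rewrite -subr_eq0 -QE pE ps0.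
(* Two families on which [Q] has opposite signs would mix into isotropic vectors of the kind just
   excluded. *)
have opposite (v w : K -> 'cV[K[i]]_n) : poly_mx v -> poly_mx w ->
    (\forall s \near F, hform (Q s) (v s) < 0) ->
    (\forall s \near F, 0 < hform (Q s) (w s)) -> False.
  move=> pv pw Qv Qw.
  have [p pE] := poly_hform pQ pv; have [q qE] := poly_hform pQ pw.
  have [p' p'E] := poly_hform (poly_mx_cst N) pv.
  have [q' q'E] := poly_hform (poly_mx_cst N) pw.
  apply: (no_family (q * p' - p * q')); apply: filterS2 Qv Qw => s.
  rewrite !QE => Qv Qw; have [y [y0 My Ny]] := mix s (v s) (w s) Qv Qw.
  exists y; split=> //.
  by rewrite Ny hornerD hornerN !hornerM -pE -qE -p'E -q'E !QE.
(* Hence [Q] has one sign on all families, and [Q] or its opposite is definite somewhere, against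
   [negQ] or [posQ]. *)
have [allpos|] := pselect (forall w : K -> 'cV[K[i]]_n, poly_mx w ->
    (\forall s \near F, w s != 0) -> \forall s \near F, 0 < hform (Q s) (w s)).
  have [s Qs] := filter_ex (eventually_posdef _ pQ hQ allpos).
  have [u Qu] := negQ s; have u0 : u != 0.
    by apply: contraTneq Qu => ->; rewrite !hform0 mulr0 subr0 ltxx.
  by have := Qs u u0; rewrite QE ltNge ltW.
move=> /existsNP[v /not_implyP[pv /not_implyP[v0 Qv]]].
have {}Qv : \forall s \near F, hform (Q s) (v s) < 0.
  by case: (Fdecide v pv v0).
pose Q' s := - M + s%:C *: N.
have Q'E s u : hform (Q' s) u = - hform (Q s) u.
  by rewrite QE hformD (hformZ s) hformN; ring.
have hQ' s : hermitian (Q' s) by apply: hermitianD; [exact: hermitianN|exact: hermitianZ].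
have allneg (w : K -> 'cV[K[i]]_n) : poly_mx w -> (\forall s \near F, w s != 0) ->
    \forall s \near F, 0 < hform (Q' s) (w s).
  move=> pw w0; case: (Fdecide w pw w0) => Qw; first by case: (opposite v w).
  by apply: filterS Qw => s; rewrite Q'E oppr_gt0.
have [s Qs] := filter_ex (eventually_posdef _ (poly_mx_pencil (- M) N) hQ' allneg).
have [u Qu] := posQ s; have u0 : u != 0.
  by apply: contraTneq Qu => ->; rewrite !hform0 mulr0 subr0 ltxx.
by have := Qs u u0; rewrite Q'E QE oppr_gt0 ltNge ltW.
Qed.

(** If some nontrivial combination is semidefinite, a small tilt in the pencil makes it definite.
    Otherwise every combination takes negative values, which [indefinite_pencil_false] rules out. *)
Lemma definite_pencil M N : hermitian M -> hermitian N ->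
  anisotropic_pair M N ->
  exists c s, forall u, u != 0 -> 0 < c * hform M u + s * hform N u.
Proof.
move=> hM hN aniso; apply: contrapT => nodef.
have neg c s : (c != 0) || (s != 0) -> exists u, c * hform M u + s * hform N u < 0.
  move=> cs0; apply: contrapT => noneg; apply: nodef.
  have cs : 0 < c ^+ 2 + s ^+ 2.
    rewrite lt0r addr_ge0 ?sqr_ge0// andbT paddr_eq0 ?sqr_ge0//.
    by rewrite !sqrf_eq0 negb_and.
  (* [(A, B)] is [(M, N)] rotated and scaled, so it has no common isotropic vector either. *)
  pose A := c%:C *: M + s%:C *: N; pose B := (- s)%:C *: M + c%:C *: N.
  have AE u : hform A u = c * hform M u + s * hform N u.
    by rewrite hformD !hformZ.
  have BE u : hform B u = - s * hform M u + c * hform N u.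
    by rewrite hformD !hformZ.
  have hA : hermitian A by apply: hermitianD; apply: hermitianZ.
  have hB : hermitian B by apply: hermitianD; apply: hermitianZ.
  have A0 u : 0 <= hform A u.
    by rewrite leNgt; apply/negP => Au; apply: noneg; exists u; rewrite -AE.
  have anisoAB u : hform A u = 0 -> hform B u = 0 -> u = 0.
    move=> Au Bu; apply: aniso; apply: (mulfI (lt0r_neq0 cs)); rewrite mulr0.
      transitivity (c * hform A u - s * hform B u); first by rewrite AE BE; ring.
      by rewrite Au Bu !mulr0 subr0.
    transitivity (s * hform A u + c * hform B u); first by rewrite AE BE; ring.
    by rewrite Au Bu !mulr0 addr0.
  have [Bpos|] := pselect (forall u, u != 0 -> hform A u = 0 -> 0 < hform B u).
    have [e e0 ABe] := psd_perturbation hA hB A0 Bpos.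
    exists (c - e * s), (s + e * c) => u /ABe; rewrite AE BE.
    by congr (0 < _); ring.
  move=> /existsNP[v /not_implyP[v0 /not_implyP[Av /negP]]].
  rewrite -leNgt le_eqVlt => /orP[/eqP Bv|Bv].
    by case/eqP: v0; exact: anisoAB.
  (* [B] has one sign on the isotropic vectors of [A]: mixing two of opposite signs would cancel [B]
     and keep [A] zero. *)
  have Bneg u : u != 0 -> hform A u = 0 -> 0 < hform (- B) u.
    rewrite hformN oppr_gt0 => u0 Au; rewrite ltNge le_eqVlt; apply/negP.
    move=> /orP[/eqP Bu|Bu]; first by case/eqP: u0; exact: anisoAB.
    have [||w [w1 Aw Bw]] := joint_range_cone u v hA hB
      (a := - hform B v) (b := hform B u); [by rewrite oppr_ge0 ltW|exact: ltW|].
    have w0 : w = 0 by apply: anisoAB; rewrite ?Aw ?Bw ?Au ?Av; ring.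
    move: w1; rewrite w0 hform0 => /esym/eqP; rewrite gt_eqF// ltr_wpDr//.
      by rewrite mulr_ge0 ?hform1_ge0// ltW.
    by rewrite mulr_gt0 ?oppr_gt0 ?hform1_gt0.
  have [e e0 ABe] := psd_perturbation hA (hermitianN hB) A0 Bneg.
  exists (c + e * s), (s - e * c) => u /ABe; rewrite hformN AE BE.
  by congr (0 < _); ring.
(* [N] takes both signs, so a mixture [x] is isotropic for [N]; the sign of [M] at [x] decides
   between [M] and [- M]. *)
have [|u] := neg 0 1; first by rewrite oner_eq0 orbT.
have [|v] := neg 0 (-1); first by rewrite oppr_eq0 oner_eq0 orbT.
rewrite !mul0r !add0r mulN1r mul1r oppr_lt0 => Nv Nu.
have [||x [x1 _ Nx]] := joint_range_cone u v hM hN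
  (a := hform N v) (b := - hform N u); [exact: ltW|by rewrite oppr_ge0 ltW|].
have {}Nx : hform N x = 0 by rewrite Nx; ring.
have x0 : x != 0.
  have u0 : u != 0 by apply: contraTneq Nu => ->; rewrite hform0 ltxx.
  apply: contra_eqN x1 => /eqP ->; rewrite hform0 eq_sym gt_eqF// ltr_wpDr//.
    by rewrite mulr_ge0 ?hform1_ge0// oppr_ge0 ltW.
  by rewrite mulr_gt0 ?hform1_gt0.
case: (ltgtP (hform M x) 0) => Mx.
- apply: (@indefinite_pencil_false (- M) N x) => //.
  + exact: hermitianN.
  + by move=> w /eqP; rewrite hformN oppr_eq0 => /eqP; exact: aniso.
  + move=> c s cs0; have [|w] := neg (- c) s; first by rewrite oppr_eq0.
    by rewrite mulNr -mulrN -hformN; exists w.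
  + by rewrite hformN oppr_gt0.
- exact: (@indefinite_pencil_false M N x).
- by case/eqP: x0; exact: aniso.
Qed.

End SeparatingPencil.

(** * The numerical range: bounded, convex, closed *)

Section NumericalRange.
Variables (K : rcfType) (n : nat).
Implicit Types (M N : 'M[K[i]]_n) (u : 'cV[K[i]]_n).

(** The coordinates of a unit vector have modulus at most 1, so the entries of [M] alone give the
    bound. *)
Lemma hform_le M u : hform 1%:M u = 1 ->
  `|hform M u| <= complex.Re (\sum_i \sum_j `|M i j|).
Proof.
move=> u1.
have u_le1 i : `|u i ord0| <= 1.
  rewrite -(@expr_le1 _ 2)// sqr_normc mulrC conjc_mulE lecR -u1 hform1E.
  by rewrite (bigD1 i)//= lerDl sumr_ge0// => j _; rewrite addr_ge0 ?sqr_ge0.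
have le : `|sform u (M *m u)| <= \sum_i \sum_j `|M i j|.
  rewrite sform_mulmxE (le_trans (ler_norm_sum _ _ _))// ler_sum// => i _.
  rewrite (le_trans (ler_norm_sum _ _ _))// ler_sum// => j _.
  rewrite !normrM normcJ mulrAC ler_piMl//.
  by rewrite mulr_ile1.
rewrite -lecR (le_trans (normc_ge_Re _))// (le_trans le)//.
by rewrite RRe_real// realE sumr_ge0// => i _; rewrite sumr_ge0.
Qed.

Lemma joint_num_rangeP M N (p : K * K) : hermitian M -> hermitian N ->
  (@real_pair K @^-1` joint_num_range M N) p <->
  exists u, [/\ hform 1%:M u = 1, hform M u = p.1 & hform N u = p.2].
Proof.
move=> hM hN; case: p => a b.
split=> [[u u1 []]|[u [/= u1 Mu Nu]]].
  rewrite (sform_hermitian u hM) (sform_hermitian u hN) => /complexI Mu /complexI Nu.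
  by exists u; split=> //; rewrite /hform mul1mx u1.
exists u => /=.
  by have := sform_hermitian u (@hermitian1 K n); rewrite mul1mx u1.
by rewrite (sform_hermitian u hM) (sform_hermitian u hN) Mu Nu.
Qed.

Lemma real_joint_num_range M N : hermitian M -> hermitian N ->
  joint_num_range M N `<=` range (@real_pair K).
Proof.
move=> hM hN _ [u _ <-]; exists (hform M u, hform N u) => //.
by rewrite (sform_hermitian u hM) (sform_hermitian u hN).
Qed.

Lemma Delta_ge0 (s : K) : Delta K s -> 0 <= s.
Proof. by move=> [a aE]; rewrite -ler0c aE mulcJ_ge0. Qed.

Lemma Delta_convex_joint_num_range M N : hermitian M -> hermitian N ->
  Delta_convex (@real_pair K @^-1` joint_num_range M N).
Proof.
move=> hM hN a b Sa Sb _ t [/Delta_ge0 t0 [s /Delta_ge0 s0 st]].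
have t1 : 0 <= 1 - t by rewrite -st; lra.
case/(joint_num_rangeP _ hM hN): Sa => u [u1 Mu Nu].
case/(joint_num_rangeP _ hM hN): Sb => v [v1 Mv Nv].
apply/(joint_num_rangeP _ hM hN).
have [w [w1 Mw Nw]] := joint_range_cone u v hM hN t0 t1.
exists w; rewrite w1 Mw Nw u1 Mu Nu v1 Mv Nv; split=> //.
by rewrite !mulr1; lra.
Qed.

Lemma bounded_joint_num_range M N : hermitian M -> hermitian N ->
  bounded_set (@real_pair K @^-1` joint_num_range M N).
Proof.
move=> hM hN; rewrite /= /bounded_near.
near=> C => p /= /(joint_num_rangeP _ hM hN)[u [u1 Mu Nu]].
rewrite [leLHS](_ : _ = Num.max `|p.1| `|p.2|)// ge_max -Mu -Nu; apply/andP; split.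
  by apply: le_trans (hform_le _ u1) _; near: C; apply: nbhs_pinfty_ge; exact: num_real.
by apply: le_trans (hform_le _ u1) _; near: C; apply: nbhs_pinfty_ge; exact: num_real.
Unshelve. all: by end_near. Qed.

Lemma closed_joint_num_range M N : hermitian M -> hermitian N ->
  closed (@real_pair K @^-1` joint_num_range M N).
Proof.
move=> hM hN [a b] clp; apply/(joint_num_rangeP _ hM hN); apply: contrapT => notin.
have subE c A u : hform (A + (- c)%:C *: 1%:M) u = hform A u - c * hform 1%:M u.
  by rewrite hformD (hformZ (- c)) mulNr.
pose M' := M + (- a)%:C *: 1%:M; pose N' := N + (- b)%:C *: 1%:M.
have hM' : hermitian M' by apply/hermitianD/hermitianZ/hermitian1.
have hN' : hermitian N' by apply/hermitianD/hermitianZ/hermitian1.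
have aniso : anisotropic_pair M' N'.
  move=> u; rewrite !subE => /eqP; rewrite subr_eq0 => /eqP Mu.
  move=> /eqP; rewrite subr_eq0 => /eqP Nu.
  apply/eqP/negPn/negP => /hform1_gt0 u0; apply: notin.
  exists ((Num.sqrt (hform 1%:M u)^-1)%:C *: u).
  rewrite !hform_scaleR sqr_sqrtr ?invr_ge0 ?hform1_ge0// Mu Nu.
  rewrite mulVf ?gt_eqF//; split=> //=; first by rewrite mulrC mulfK ?gt_eqF.
  by rewrite mulrC mulfK ?gt_eqF.
have [c [s cs]] := definite_pencil hM' hN' aniso.
pose A := c%:C *: M' + s%:C *: N'.
have AE u : hform A u = c * hform M' u + s * hform N' u.
  by rewrite hformD !hformZ.
have hA : hermitian A by apply: hermitianD; apply: hermitianZ.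
(* Perturbing by minus the identity turns definiteness of [A] into a uniform lower bound [e] on the
   unit sphere. *)
have [u||e e0 eA] := psd_perturbation hA (hermitianN (@hermitian1 K n)).
- have [->|u0] := eqVneq u 0; first by rewrite hform0.
  by rewrite AE ltW// cs.
- by move=> u u0; rewrite AE => Au; have := cs u u0; rewrite Au ltxx.
have d0 : 0 < 1 + `|c| + `|s| by have := normr_ge0 c; have := normr_ge0 s; lra.
(* At this radius the combination with coefficients [c] and [s] varies by less than [e]; the summand
   1 keeps the denominator positive. *)
have [[a' b'] /= [/(joint_num_rangeP _ hM hN)[u [/= u1 Mu Nu]] [/=]]] :=
  clp _ (nbhsx_ballx (a, b) (e / (1 + `|c| + `|s|)) (divr_gt0 e0 d0)).
rewrite /ball /= !ltr_pdivlMr// => aa' bb'.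
have u0 : u != 0.
  by apply: contra_eqN u1 => /eqP ->; rewrite hform0 eq_sym oner_eq0.
suff : c * (a' - a) + s * (b' - b) < e.
  move=> lte; have := eA u u0; rewrite AE !subE hformN u1 Mu Nu !mulr1 mulrN1.
  by rewrite subr_gt0 ltNge (ltW lte).
apply: (@le_lt_trans _ _ (`|c| * `|a - a'| + `|s| * `|b - b'|)).
  by rewrite lerD// (le_trans (ler_norm _))// normrM distrC.
rewrite -(ltr_pM2r d0) mulrDl.
apply: (@le_lt_trans _ _ (`|c| * e + `|s| * e)).
  by rewrite lerD// -mulrA ler_wpM2l// ltW.
lra.
Qed.

End NumericalRange.

Theorem corollary1 (K : rcfType) (n : nat) (hn : (1 <= n)%N)
    (M N : 'M[K[i]]_n) (hM : dagger M = M) (hN : dagger N = N) :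
  joint_num_range M N `<=` range (@real_pair K) /\
  closed (@real_pair K @^-1` joint_num_range M N) /\
  bounded_set (@real_pair K @^-1` joint_num_range M N) /\
  Delta_convex (@real_pair K @^-1` joint_num_range M N).
Proof.
split; first exact: real_joint_num_range.
split; first exact: closed_joint_num_range.
split; first exact: bounded_joint_num_range.
exact: Delta_convex_joint_num_range.
Qed.
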